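(* Let $G$ be a finite directed graph which is connected, has no circuit, and has no transitivity edge (no edge $(u,v)$ such that there is also a chain of length at least $2$ from $u$ to $v$). Let $c$ be a chain of $G$, let $V_c$ be the set of vertices of $c$ (including its origin and end), let $G_1,\dots,G_k$ be the connected components of the subgraph of $G$ induced on $V_G\setminus V_c$, and for each $j$ let $\overline{G_j}$ be the subgraph of $G$ induced on $V(G_j)\cup V_c$ (the regions of $G$ with respect to $c$). Then $$N(G)=\prod_{j=1}^kN(\overline{G_j}).$$
   Context: A graph $G$ has a finite vertex set $V_G$ and edge set $E_G\subset V_G\times V_G$; for $e=(u,v)$, $\alpha(e)=u$, $\omega(e)=v$. A chain is a sequence of edges $(e_1,\dots,e_k)$ of $G$ with $\omega(e_i)=\alpha(e_{i+1})$ for $i<k$, all edges and vertices distinct; a circuit is a chain with additionally $\omega(e_k)=\alpha(e_1)$. The subgraph induced on $V'\subset V_G$ has vertex set $V'$ and all edges of $G$ with both endpoints in $V'$. Connectedness refers to the underlying undirected graph. A linear extension of $G$ is a total order on $V_G$ with $\alpha(e)$ before $\omega(e)$ for every edge, written as the word $w=w_1\cdots w_n$ in increasing order; $\mathcal L(G)$ is their set. $\Psi(G)=\sum_{w\in\mathcal L(G)}\prod_{i=1}^{n-1}(x_{w_i}-x_{w_{i+1}})^{-1}$ and $N(G)=\Psi(G)\prod_{e\in E_G}(x_{\alpha(e)}-x_{\omega(e)})$. *)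

(* Defs.v *)
From HB Require Import structures.
From mathcomp Require Export all_boot all_order all_algebra.
From mathcomp Require Export mpoly.

Set Implicit Arguments.
Unset Strict Implicit.
Unset Printing Implicit Defensive.

Import GRing.Theory.

(* Graphs live inside an ambient finite type T of labels, so that a graph and
   its subgraphs share the variables x_t (t : T). *)
Record digraph (T : finType) := Digraph {
  vset : {set T};
  eset : {set T * T};
  eset_sub : eset \subset setX vset vset
}.

Section Digraph.
Variable T : finType.
Implicit Types (G : digraph T) (c : seq (T * T)) (u v : T).

(* For an edge e, alpha(e) is e.1 and omega(e) is e.2. *)
Definition consecutive : rel (T * T) := [rel e f | e.2 == f.1].

(* The word alpha(e_1) omega(e_1) ... omega(e_k) of vertices met by c. *)
Definition chain_word c : seq T :=
  if c is e :: _ then e.1 :: [seq f.2 | f <- c] else [::].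

Definition chain_vset c : {set T} := [set:: chain_word c].

(* Chains have at least one edge, so that their origin and end make sense. *)
Definition chain G c : bool :=
  [&& c != [::], all (mem (eset G)) c, sorted consecutive c,
      uniq c & uniq (chain_word c)].

(* [cycle consecutive c] also requires omega(e_k) = alpha(e_1); apart from this
   coincidence the vertices are distinct. A loop is a circuit of length 1. *)
Definition circuit G c : bool :=
  [&& c != [::], all (mem (eset G)) c, cycle consecutive c,
      uniq c & uniq [seq e.1 | e <- c]].

(* The default values of head and last are irrelevant since c != [::]. *)
Definition chain_from_to G u v c : bool :=
  [&& chain G c, (head (u, v) c).1 == u & (last (u, v) c).2 == v].

Definition transitivity_edge G (e : T * T) : Prop :=
  e \in eset G /\ exists2 c, chain_from_to G e.1 e.2 c & 2 <= size c.

Definition adjacent G : rel T :=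
  [rel u v | ((u, v) \in eset G) || ((v, u) \in eset G)].

Definition connected_graph G : Prop :=
  {in vset G &, forall u v, connect (adjacent G) u v}.

(* The vertex sets of the connected components. *)
Definition components G : {set {set T}} :=
  equivalence_partition (connect (adjacent G)) (vset G).

Lemma induced_sub G (W : {set T}) :
  eset G :&: setX (vset G :&: W) (vset G :&: W)
    \subset setX (vset G :&: W) (vset G :&: W).
Proof. exact: subsetIr. Qed.

Definition induced G (W : {set T}) : digraph T := Digraph (induced_sub G W).

Definition linear_extensions G : {set #|vset G|.-tuple T} :=
  [set w : #|vset G|.-tuple T | perm_eq w (enum (vset G)) &
     [forall e in eset G, index e.1 w < index e.2 w]].

Local Open Scope ring_scope.

Definition ratfun : fieldType := {fraction {mpoly rat[#|T|]}}.

Definition xvar v : ratfun := tofrac 'X_(enum_rank v).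

(* zip w (behead w) lists the pairs (w_i, w_(i+1)), 1 <= i <= n - 1. *)
Definition Psi G : ratfun :=
  \sum_(w in linear_extensions G)
    \prod_(p <- zip w (behead w)) (xvar p.1 - xvar p.2)^-1.

Definition numer G : ratfun :=
  Psi G * \prod_(e in eset G) (xvar e.1 - xvar e.2).

End Digraph.

(* Main.v *)
Require Import Defs.
From mathcomp Require Import ring.

(* Let w = v_0 ... v_m be the vertex word of the chain and P(w) the product of
   the 1 / (x_{v_i} - x_{v_(i+1)}). The heart of the proof is the identity
     Psi(A + B + w) P(w) = Psi(A + w) Psi(B + w)
   for disjoint vertex sets A and B joined by no edge. To prove it by induction
   on the number of vertices, it is generalised to sums over words u s with a
   prescribed extra first letter u: splitting off the next letter, the
   induction step becomes the partial fraction identity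
     (a-c)/((u-a)(a-b)) + (b-c)/((u-b)(b-a)) = (u-c)/((u-a)(u-b)),
   where c is the first letter of w. Applied to the components one by one, the
   identity gives Psi(G) / P(w) as the product of the Psi(G_j + w) / P(w). Since
   there are neither circuits nor transitivity edges, the edges between
   vertices of the chain are exactly those of the chain, so that the product
   over all edges splits in the same way. *)

Set Implicit Arguments.
Unset Strict Implicit.
Unset Printing Implicit Defensive.

Import GRing.Theory.
Local Open Scope ring_scope.

(** * Sums over linear extensions, split by their first letter *)

Section RootedSums.

Variables (T : finType) (E : {set T * T}) (K : fieldType) (x : T -> K).
Hypothesis x_inj : injective x.
Implicit Types (S A B D : {set T}) (u : option T) (w s : seq T) (z : T).

(* The root [None] stands for the absence of a letter before [z]. *)
Definition link u z : K := if u is Some y then (x y - x z)^-1 else 1.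

Fixpoint weight u w : K :=
  if w is z :: w' then link u z * weight (Some z) w' else 1.

Definition source S z := (z \in S) && [forall y in S, (y, z) \notin E].

(* The sum of [weight u w] over the linear extensions w of the graph induced by
   [E] on [S], organised by the first letter of w; [n] is the size of [S]. *)
Fixpoint rooted_sum_rec n u S : K :=
  if n is m.+1 then
    \sum_(z | source S z) link u z * rooted_sum_rec m (Some z) (S :\ z)
  else 1.

Definition rooted_sum u S := rooted_sum_rec #|S| u S.

(** The contribution of the words that start with [z], apart from the link to the root. The value 0
    off the sources lets sums range over all of [S]. *)
Definition tail_sum S z :=
  if source S z then rooted_sum (Some z) (S :\ z) else 0.

(** Keeps the denominators between the root and the letters of [S] nonzero; vacuous for [None]. *)
Definition fresh u S := forall y, u = Some y -> y \notin S.

Definition separated A B :=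
  forall a b, a \in A -> b \in B ->
  [/\ a != b, (a, b) \notin E & (b, a) \notin E].

Lemma subx_neq0 y z : y != z -> x y - x z != 0.
Proof. by rewrite subr_eq0 (inj_eq x_inj). Qed.

Lemma rooted_sum0 u : rooted_sum u set0 = 1.
Proof. by rewrite /rooted_sum cards0. Qed.

Lemma rooted_sumE u S : S != set0 ->
  rooted_sum u S = \sum_(z in S) link u z * tail_sum S z.
Proof.
move=> S0; rewrite /rooted_sum; case En: #|S| => [|n].
  by move/eqP: En S0; rewrite cards_eq0 => ->.
rewrite /= [RHS](bigID (source S)) /= [X in _ + X]big1 ?addr0; last first.
  by move=> z /andP[_ /negPf nz]; rewrite /tail_sum nz mulr0.
apply: eq_big => [z|z zS]; first by rewrite andbC andb_idr // => /andP[].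
rewrite /tail_sum zS /rooted_sum.
by move: En; rewrite (cardsD1 z) (proj1 (andP zS)) add1n => -[->].
Qed.

Lemma separated_sym A B : separated A B -> separated B A.
Proof. by move=> sAB a b aB bA; rewrite eq_sym; case: (sAB b a bA aB). Qed.

Lemma separatedD1 A B a : separated A B -> separated (A :\ a) B.
Proof. by move=> sAB a' b /setD1P[_ aA]; apply: sAB. Qed.

Lemma separated_notin A B a : separated A B -> a \in A -> a \notin B.
Proof. by move=> sAB aA; apply/negP => /(sAB _ _ aA)[/eqP]. Qed.

Lemma sum_disjointU A B (F : T -> K) : [disjoint A & B] ->
  \sum_(z in A :|: B) F z = \sum_(z in A) F z + \sum_(z in B) F z.
Proof. by move=> dAB; rewrite -bigU //; apply: eq_bigl => z; rewrite !inE. Qed.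

Lemma sum_separatedU A B (F : T -> K) : separated A B ->
  \sum_(z in A :|: B) F z = \sum_(z in A) F z + \sum_(z in B) F z.
Proof.
move=> sAB; apply: sum_disjointU.
by rewrite disjoint_subset; apply/subsetP => z /(separated_notin sAB).
Qed.

Lemma source_separatedU A B D z : separated A B -> z \in A ->
  source (A :|: B :|: D) z = source (A :|: D) z.
Proof.
move=> sAB zA; rewrite /source !inE zA /=.
apply/forall_inP/forall_inP => h y; rewrite !inE => yS.
  by apply: h; rewrite !inE; case/orP: yS => ->; rewrite ?orbT.
have [yB|yB] := boolP (y \in B); first by case: (sAB z y zA yB).
by apply: h; rewrite !inE; move: yS; rewrite (negPf yB) orbF.
Qed.

Lemma setUD1l A B z : z \notin B -> (A :|: B) :\ z = (A :\ z) :|: B.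
Proof.
move=> zB; rewrite setDUl; congr (_ :|: _); apply/setDidPl.
by rewrite disjoint_sym disjoints1.
Qed.

(** No edge runs from [B] to [A], so [B] has no say in whether [z] may come first, and it survives
    intact when [z] is removed. *)
Lemma tail_sum_separatedU A B D z : separated A B -> z \in A -> z \notin D ->
  tail_sum (A :|: B :|: D) z =
  if source (A :|: D) z then rooted_sum (Some z) (A :\ z :|: B :|: D) else 0.
Proof.
move=> sAB zA zD; rewrite /tail_sum source_separatedU //.
by rewrite !setUD1l // (separated_notin sAB).
Qed.

(** * Partial fractions, and two separated sets under a common root *)

Lemma partial_fractions (u z y : T) : z != y -> u != z -> u != y ->
  (x u - x z)^-1 * (x z - x y)^-1 + (x u - x y)^-1 * (x y - x z)^-1 =
  (x u - x z)^-1 * (x u - x y)^-1.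
Proof.
move=> zy uz uy; have := subx_neq0 zy; have := subx_neq0 uz.
have := subx_neq0 uy; have : x y - x z != 0 by rewrite subx_neq0 // eq_sym.
by move=> h1 h2 h3 h4; field; rewrite h1 h2 h3 h4.
Qed.

(** The identity of the induction step for chains, divided by [x u - x c]. Without a root all links
    are 1 and it becomes (z-c)/(z-y) + (y-c)/(y-z) = 1. *)
Lemma partial_fractions_chain u c z y :
    z != y -> z != c -> y != c -> fresh u [set c; z; y] ->
  link u c * (link u z * (x z - x c) * (x z - x y)^-1
              + link u y * (x y - x c) * (x y - x z)^-1) =
  link u z * link u y.
Proof.
move=> zy zc yc fu; have h1 := subx_neq0 zy.
have h2 : x y - x z != 0 by rewrite subx_neq0 // eq_sym.
case: u fu => [u|] /= fu; last by field; rewrite h1 h2.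
have := fu u erefl; rewrite !inE !negb_or -andbA => /and3P[uc uz uy].
by field; rewrite !subx_neq0 // eq_sym.
Qed.

(** The case of an exhausted chain, whose last vertex is [u]. The root has to be a genuine letter:
    without it the two partial fractions would cancel instead of giving a product. *)
Lemma rooted_sumU A B (u : T) : separated A B -> u \notin A :|: B ->
  rooted_sum (Some u) (A :|: B) = rooted_sum (Some u) A * rooted_sum (Some u) B.
Proof.
have [n] := ubnP (#|A| + #|B|)%N; elim: n A B u => // n IH A B u leAB sAB uAB.
have [->|A0] := eqVneq A set0; first by rewrite rooted_sum0 mul1r set0U.
have [->|B0] := eqVneq B set0; first by rewrite rooted_sum0 mulr1 setU0.
(* For words starting in [A'], the induction hypothesis with root [z] separates off [B'], which is
   then expanded by its own first letter. *)
have tl A' B' z : (#|A'| + #|B'| < n.+1)%N -> B' != set0 ->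
    separated A' B' -> z \in A' -> tail_sum (A' :|: B') z =
    tail_sum A' z * \sum_(y in B') (x z - x y)^-1 * tail_sum B' y.
  move=> le' B'0 s' zA'; rewrite -[A' :|: B']setU0 tail_sum_separatedU ?inE //.
  rewrite !setU0 [in RHS]/tail_sum; case: ifP => _; last by rewrite mul0r.
  rewrite IH ?[X in _ * X]rooted_sumE //.
  - by rewrite (leq_trans _ (ltnSE le')) // ltn_add2r (cardsD1 z A') zA'.
  - exact: separatedD1.
  - by rewrite !inE eqxx (separated_notin s').
rewrite rooted_sumE ?setU_eq0 ?negb_and ?A0 // sum_separatedU //.
rewrite [in RHS]rooted_sumE // [X in _ * X]rooted_sumE //.
under eq_bigr => z zA do rewrite tl //.
under [X in _ + X]eq_bigr => z zB.
  rewrite setUC tl // 1?addnC //; last exact: separated_sym.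
  over.
rewrite mulr_suml.
under [RHS]eq_bigr do rewrite mulr_sumr.
under eq_bigr do rewrite mulrA mulr_sumr.
under [X in _ + X]eq_bigr do rewrite mulrA mulr_sumr.
(* All double sums now run over pairs of first letters, one in [A] and one in [B], and are compared
   term by term. *)
rewrite [X in _ + X]exchange_big -big_split; apply: eq_bigr => z zA /=.
rewrite -big_split; apply: eq_bigr => y yB /=.
case: (sAB z y zA yB) => zy _ _.
move: uAB; rewrite inE negb_or => /andP[uA uB].
have uz : u != z by apply: contraNneq uA => ->.
have uy : u != y by apply: contraNneq uB => ->.
transitivity ((x u - x z)^-1 * (x u - x y)^-1 * (tail_sum A z * tail_sum B y)).
  by rewrite -partial_fractions //; ring.
by ring.
Qed.

(** * Sums over words that contain a fixed chain *)

Notation chained := (sorted (fun y z => (y, z) \in E)).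

(** Every vertex of [s] has an incoming edge from its predecessor on the chain, so only [c] or a
    vertex of [A] can come first. *)
Lemma rooted_sum_chainE A u c s : chained (c :: s) -> uniq (c :: s) ->
    [disjoint A & c :: s] ->
  rooted_sum u (A :|: [set:: c :: s]) =
  \sum_(z in A) link u z * tail_sum (A :|: [set:: c :: s]) z
  + link u c * tail_sum (A :|: [set:: c :: s]) c.
Proof.
move=> ch un dA; set S := A :|: _.
have cS : c \in S by rewrite !inE eqxx orbT.
rewrite rooted_sumE; last by apply/set0Pn; exists c.
have dA' : [disjoint A & [set:: c :: s]].
  rewrite disjoint_subset; apply/subsetP => z zA.
  by rewrite inE /= inE (disjointFr dA zA).
rewrite sum_disjointU //=; congr (_ + _).
rewrite (bigD1 c) ?inE ?eqxx //= big1 ?addr0 // => z /andP[zs zc].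
suff /negPf nz : ~~ source S z by rewrite /tail_sum nz mulr0.
move: zs; rewrite !inE (negPf zc) /= => zs.
have [s1 [s2 ds]] : exists s1 s2, s = s1 ++ z :: s2.
  by case/splitPr: zs => s1 s2; exists s1, s2.
rewrite /source negb_and negb_forall_in; apply/orP; right.
move: ch; rewrite /= ds cat_path /= => /and3P[_ e _].
apply/existsP; exists (last c s1); rewrite negbK e andbT /S !inE -in_cons.
by rewrite ds -cat_cons mem_cat mem_last orbT.
Qed.

Lemma weight_neq0 u w : fresh u [set:: w] -> uniq w -> weight u w != 0.
Proof.
elim: w u => [|z w IH] u fu /=; first by rewrite oner_neq0.
case/andP=> zw uw; rewrite mulf_neq0 ?IH //; last by move=> y [<-]; rewrite inE.
case: u fu => [u|] fu /=; last by rewrite oner_neq0.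
have := fu u erefl; rewrite !inE negb_or => /andP[uz _].
by rewrite invr_neq0 // subx_neq0.
Qed.

(** Whichever letter comes first becomes the new root: a letter of [A] or [B] shrinks that set, and
    [c] shortens the chain. Hence the induction on the total size. *)
Lemma rooted_sum_chainU A B u c s : chained (c :: s) -> uniq (c :: s) ->
    [disjoint A & c :: s] -> [disjoint B & c :: s] -> separated A B ->
    fresh u (A :|: B :|: [set:: c :: s]) ->
  rooted_sum u (A :|: B :|: [set:: c :: s]) * weight u (c :: s) =
  rooted_sum u (A :|: [set:: c :: s]) * rooted_sum u (B :|: [set:: c :: s]).
Proof.
have [n] := ubnP (#|A| + #|B| + size (c :: s))%N.
elim: n A B u c s => // n IH A B u c s leAB ch un dA dB sAB fu.
have dAB : [disjoint A :|: B & c :: s].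
  rewrite disjoint_subset; apply/subsetP => z; rewrite in_setU inE /=.
  by case/orP => [/(disjointFr dA)|/(disjointFr dB)] ->.
have cA : c \notin A by apply/negP => /(disjointFr dA); rewrite inE eqxx.
have cB : c \notin B by apply/negP => /(disjointFr dB); rewrite inE eqxx.
(* Once [c] has been read it is the root for the rest of the chain; if nothing is left,
   [rooted_sumU] takes over. *)
have key : rooted_sum (Some c) (A :|: B :|: [set:: s]) * weight (Some c) s =
    rooted_sum (Some c) (A :|: [set:: s]) *
    rooted_sum (Some c) (B :|: [set:: s]).
  case: s {dAB fu} => [|d s] in ch un dA dB leAB *.
    rewrite set_nil !setU0 mulr1.
    by apply: rooted_sumU => //; rewrite inE negb_or cA.
  have /andP[cs us] := un.
  have ss : {subset d :: s <= [:: c, d & s]}.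
    by move=> y yd; rewrite inE yd orbT.
  apply: IH => //.
  - by move: leAB; rewrite /= !addnS ltnS.
  - by case/andP: ch.
  - by rewrite (disjointWr _ dA) //; apply/subsetP.
  - by rewrite (disjointWr _ dB) //; apply/subsetP.
  - by move=> y [<-]; rewrite !in_setU !negb_or cA cB inE.
rewrite !rooted_sum_chainE // sum_separatedU //.
set C := [set:: c :: s]; set p := weight (Some c) s.
have /andP[cs us] := un.
have p0 : p != 0 by apply: weight_neq0 => // y [<-]; rewrite inE.
(* The factor [x z - x c] compensates for the link from [z] to [c] in the weight of the induction
   hypothesis. The sum over [B' :|: C] rooted at [z] is then split by its first letter; for the
   letter [c] the two factors cancel. *)
have tl A' B' z : (#|A'| + #|B'| + size (c :: s) < n.+1)%N ->
    [disjoint A' & c :: s] -> [disjoint B' & c :: s] ->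
    separated A' B' -> z \in A' -> tail_sum (A' :|: B' :|: C) z * p =
    tail_sum (A' :|: C) z * (x z - x c) * (\sum_(y in B')
      (x z - x y)^-1 * tail_sum (B' :|: C) y) +
    tail_sum (A' :|: C) z * tail_sum (B' :|: C) c.
  move=> le' dA' dB' s' zA'; have zC := disjointFr dA' zA'.
  have zC' : z \notin C by rewrite inE zC.
  rewrite tail_sum_separatedU //.
  rewrite [tail_sum (A' :|: C) _]/tail_sum.
  case: ifP => _; last by rewrite !mul0r addr0.
  have zc : z != c by apply: contraFneq zC => ->; rewrite inE eqxx.
  have h0 := subx_neq0 zc.
  rewrite -mulrA -mulrDr.
  rewrite (_ : p = (x z - x c) * weight (Some z) (c :: s)); last first.
    by rewrite /= mulrA mulfV // mul1r.
  rewrite mulrCA IH //; first last.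
  - move=> y [<-]; rewrite !inE eqxx -in_cons zC.
    by rewrite (negPf (separated_notin s' zA')).
  - exact: separatedD1.
  - by rewrite (disjointWl _ dA') // subsetDl.
  - by rewrite (leq_trans _ (ltnSE le')) // !ltn_add2r (cardsD1 z A') zA'.
  rewrite setUD1l // mulrCA; congr (_ * _).
  by rewrite (rooted_sum_chainE _ ch un dB') mulrDr mulrA mulfV ?mul1r.
have tlc : tail_sum (A :|: B :|: C) c * p =
    tail_sum (A :|: C) c * tail_sum (B :|: C) c.
  have CD : C :\ c = [set:: s].
    by rewrite /C set_cons setU1K // inE.
  have UD D : c \notin D -> (D :|: C) :\ c = D :|: [set:: s].
    by move=> cD; rewrite setUC setUD1l // CD setUC.
  rewrite /tail_sum !UD // ?inE ?negb_or ?cA //.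
  have -> : source (A :|: B :|: C) c = source (A :|: C) c && source (B :|: C) c.
    rewrite /source !inE eqxx !orbT /=.
    apply/forall_inP/andP => [h|[/forall_inP h1 /forall_inP h2] y].
      by split; apply/forall_inP => y; rewrite in_setU => /orP[] yS;
        apply: h; rewrite !in_setU yS ?orbT.
    by rewrite in_setU => /orP[/setUP[]|] yS; [apply: h1|apply: h2|apply: h1];
      rewrite in_setU yS ?orbT.
  case: (source _ _); case: (source _ _); rewrite ?(mul0r, mulr0) //=.
rewrite /= -/p mulrCA [_ * p]mulrDl [_ * p]mulrDl !mulr_suml.
under [X in _ * (X + _ + _)]eq_bigr => z zA do rewrite -mulrA tl //.
under [X in _ * (_ + X + _)]eq_bigr => z zB.
  rewrite -mulrA [A :|: B]setUC tl //; first last.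
  - exact: separated_sym.
  - by rewrite [(#|B| + _)%N]addnC.
  over.
rewrite -[_ * _ * p]mulrA tlc.
under eq_bigr do rewrite mulrDr.
under [X in _ * (_ + X + _)]eq_bigr do rewrite mulrDr.
rewrite !big_split /=.
set phi := tail_sum (A :|: C); set psi := tail_sum (B :|: C).
set U := \sum_(z in A) link u z * phi z.
set V := \sum_(y in B) link u y * psi y.
have -> : \sum_(z in A) link u z * (phi z * psi c) = U * psi c.
  by rewrite mulr_suml; apply: eq_bigr => z _; rewrite mulrA.
have -> : \sum_(y in B) link u y * (psi y * phi c) = V * phi c.
  by rewrite mulr_suml; apply: eq_bigr => y _; rewrite mulrA.
set U1 := \sum_(z in A) _; set V1 := \sum_(y in B) _.
(* After expansion the terms with [phi c] or [psi c] agree on both sides, and only the double sums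
   over [A] and [B] remain. *)
suff UV : link u c * (U1 + V1) = U * V.
  transitivity (link u c * (U1 + V1) + link u c * U * psi c
    + link u c * V * phi c + link u c * link u c * phi c * psi c).
    by ring.
  by rewrite UV; ring.
rewrite /U1 /V1 /U /V mulr_suml.
under [RHS]eq_bigr do rewrite mulr_sumr.
under [X in _ * (X + _)]eq_bigr do rewrite mulrA mulr_sumr.
under [X in _ * (_ + X)]eq_bigr do rewrite mulrA mulr_sumr.
rewrite [X in _ * (_ + X)]exchange_big -big_split mulr_sumr.
apply: eq_bigr => z zA /=.
rewrite -big_split mulr_sumr; apply: eq_bigr => y yB /=.
case: (sAB z y zA yB) => zy _ _.
(* It remains to compare the coefficients of [phi z * psi y]. *)
transitivity (link u z * link u y * (phi z * psi y)); last by ring.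
rewrite -(@partial_fractions_chain u c) //; first by ring.
- by apply: contraNneq cA => <-.
- by apply: contraNneq cB => <-.
move=> v uv; have := fu v uv; apply: contraNN; rewrite !inE.
by case/orP=> [/orP[]|] /eqP->; rewrite ?zA ?yB ?eqxx ?orbT.
Qed.

Lemma weight_zip w :
  weight None w = \prod_(p <- zip w (behead w)) (x p.1 - x p.2)^-1.
Proof.
case: w => [|z w] /=; first by rewrite big_nil.
rewrite mul1r; elim: w z => [|y w IH] z /=; first by rewrite big_nil.
by rewrite big_cons IH.
Qed.

(** Without loops and backward edges the chain is the only linear extension of its own vertex
    set. *)
Lemma rooted_sum_chain u w : chained w -> uniq w ->
    pairwise (fun y z => (z, y) \notin E) w ->
    {in w, forall z, (z, z) \notin E} ->
  rooted_sum u [set:: w] = weight u w.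
Proof.
elim: w u => [|c w IH] u ch un pw nl.
  by rewrite set_nil rooted_sum0.
have /andP[cw uw] := un; move: pw; rewrite pairwise_cons => /andP[/allP cpw pw].
rewrite -[[set:: _]]set0U rooted_sum_chainE //; last first.
  by rewrite disjoint_subset; apply/subsetP => z; rewrite inE.
rewrite big_set0 add0r set0U /= /tail_sum.
have -> : source [set:: c :: w] c.
  rewrite /source !inE eqxx /=; apply/forall_inP => y; rewrite !inE.
  by case/orP => [/eqP->|/cpw //]; apply: nl; rewrite inE eqxx.
rewrite set_cons setU1K ?inE // IH //; last first.
  by move=> z zw; apply: nl; rewrite inE zw orbT.
by case: (w) ch => //= d w' /andP[].
Qed.

(** Division by the weight of the chain makes the identity multiplicative, so the sets can be peeled
    off one at a time; the empty product corresponds to the chain alone. *)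
Lemma rooted_sum_chain_bigcup (Cs : seq {set T}) w : w != [::] ->
    chained w -> uniq w ->
    pairwise (fun y z => (z, y) \notin E) w ->
    {in w, forall z, (z, z) \notin E} ->
    uniq Cs -> {in Cs &, forall C D, C != D -> separated C D} ->
    {in Cs, forall C : {set T}, [disjoint C & w]} ->
  rooted_sum None ((\bigcup_(C <- Cs) C) :|: [set:: w]) / weight None w =
  \prod_(C <- Cs) (rooted_sum None (C :|: [set:: w]) / weight None w).
Proof.
move=> w0 ch un pw nl.
have W0 : weight None w != 0 by apply: weight_neq0 => // y.
elim: Cs => [|C Cs IH] uC sC dC.
  by rewrite !big_nil set0U rooted_sum_chain // mulfV.
have /andP[nC uCs] := uC.
rewrite [in RHS]big_cons -IH //; first last.
- by move=> D DC; apply: dC; rewrite inE DC orbT.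
- by move=> D D' DC DC'; apply: sC; rewrite inE ?DC ?DC' orbT.
rewrite big_cons; case: w w0 ch un dC {pw nl IH} W0 => [//|c w] _ ch un dC W0.
rewrite -[X in X / _](mulfK W0) rooted_sum_chainU //.
- by rewrite -!mulrA [in RHS](mulrCA _^-1).
- by apply: dC; rewrite inE eqxx.
- rewrite disjoint_subset; apply/subsetP => z.
  rewrite bigcup_seq => /bigcupP[D DC zD].
  by rewrite inE /= (disjointFr (dC D _) zD) // inE DC orbT.
move=> a b aC; rewrite bigcup_seq => /bigcupP[D DC bD].
apply: (sC C D) => //; rewrite ?inE ?eqxx ?DC ?orbT //.
by apply: contraNneq nC => ->.
Qed.

(** * Linear extensions as lists of words *)

Definition linear_word w :=
  forall y z, (y, z) \in E -> y \in w -> z \in w -> (index y w < index z w)%N.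

Fixpoint linear_words n S : seq (seq T) :=
  if n is m.+1 then
    [seq z :: w | z <- enum (source S), w <- linear_words m (S :\ z)]
  else [:: [::]].

Lemma rooted_sum_words n u S :
  rooted_sum_rec n u S = \sum_(w <- linear_words n S) weight u w.
Proof.
elim: n u S => [|n IH] u S /=; first by rewrite big_seq1.
rewrite big_allpairs_dep /= big_enum_cond /=.
apply: eq_big => z; first by rewrite andbT.
by move=> _; rewrite IH mulr_sumr.
Qed.

Lemma linear_words_uniq n S : uniq (linear_words n S).
Proof.
elim: n S => [|n IH] S //=.
apply: allpairs_uniq_dep => [|z _|]; rewrite ?enum_uniq //.
by move=> [z w] [z' w'] _ _ /= [-> ->].
Qed.

(** A linear extension starts with a source and continues with a linear extension of the remaining
    set; conversely, prepending a source violates no edge. *)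
Lemma linear_wordsP n S w : #|S| = n ->
  reflect [/\ uniq w, w =i S & linear_word w] (w \in linear_words n S).
Proof.
elim: n S w => [|n IH] S w cS /=.
  move/eqP: cS; rewrite cards_eq0 => /eqP->; rewrite inE.
  apply: (iffP eqP) => [->|[_ wS _]]; first by split=> // z; rewrite !inE.
  by case: w wS => // z w /(_ z); rewrite !inE eqxx.
have card_tl z : z \in S -> #|S :\ z| = n.
  by move=> zS; move: cS; rewrite (cardsD1 z) zS add1n => -[].
apply: (iffP allpairsPdep) => [[z [w' [zS w'S ->]]]|[]].
  rewrite mem_enum in zS; have /andP[zS1 /forall_inP zS2] := zS.
  have [uw' w'E lw'] := IH _ _ (card_tl z zS1) w'S.
  have zw' : z \notin w' by rewrite w'E !inE eqxx.
  have mS : z :: w' =i S.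
    by move=> y; rewrite inE w'E !inE; case: eqVneq => [->|].
  split=> //=; first by rewrite zw'.
  move=> y t yt yS tS /=; rewrite mS in yS; have [tz|tz] := eqVneq z t.
    by move: yt; rewrite -tz (negPf (zS2 y yS)).
  have [//|yz] := eqVneq z y.
  rewrite ltnS; apply: lw' => //; first by rewrite w'E !inE eq_sym yz.
  by move: tS; rewrite inE eq_sym (negPf tz).
case: w => [_ wS|z w /= /andP[zw uw] wS lw].
  move: cS; rewrite (_ : S = set0) ?cards0 //.
  by apply/setP => z; rewrite -wS !inE.
have zS : z \in S by rewrite -wS inE eqxx.
exists z, w; split => //.
  rewrite mem_enum; apply/andP; split=> //; apply/forall_inP => y yS.
  apply/negP => yz; have := lw y z yz.
  rewrite wS yS inE eqxx /= => /(_ isT isT).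
  by rewrite eqxx ltn0.
apply/IH; [exact: card_tl|split=> // [y|y t yt yw tw]].
  by rewrite !inE -wS inE; case: eqVneq => [->|//]; rewrite (negPf zw).
have := lw y t yt; rewrite !inE yw tw !orbT => /(_ isT isT) /=.
have [zy|_] := eqVneq z y; first by rewrite zy yw in zw.
by have [zt|_] := eqVneq z t; first by rewrite zt tw in zw.
Qed.

End RootedSums.

(** * The function [Psi] as a rooted sum *)

Lemma xvar_inj (T : finType) : injective (@xvar T).
Proof.
move=> y z /eqP; rewrite /xvar tofrac_eq => /eqP.
move=> /(congr1 (fun p => p@_(U_(enum_rank y)))).
rewrite !mcoeffX eqxx; case: eqP => [/eqP|_ /eqP]; last by rewrite oner_eq0.
by rewrite eq_mnm1 => /eqP /enum_rank_inj ->.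
Qed.

(** Taking [E] to be the edge set of an ambient graph lets the whole graph and all its regions be
    handled with one and the same [E]. *)
Lemma Psi_rooted_sum (T : finType) (E : {set T * T}) (G : digraph T) :
    eset G = E :&: setX (vset G) (vset G) ->
  Psi G = rooted_sum E (@xvar T) None (vset G).
Proof.
move=> EG; rewrite /rooted_sum rooted_sum_words /Psi.
under eq_bigr do rewrite -weight_zip.
rewrite -big_enum -(big_map val xpredT (weight (@xvar T) None)) /=.
apply: perm_big; apply: uniq_perm.
- by rewrite map_inj_uniq ?enum_uniq //; apply: val_inj.
- exact: linear_words_uniq.
move=> w; apply/mapP/(linear_wordsP _ _ erefl) => [[t]|[uw wS lw]].
  rewrite mem_enum inE => /andP[pt /forall_inP lt] ->.
  have tS : t =i vset G by move=> z; rewrite (perm_mem pt) mem_enum.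
  split=> //; first by rewrite (perm_uniq pt) enum_uniq.
  by move=> y z yz yt zt; apply: (lt (y, z)); rewrite EG !inE yz -!tS yt zt.
have pw : perm_eq w (enum (vset G)).
  by apply: uniq_perm; rewrite ?enum_uniq // => z; rewrite mem_enum.
have sw : size w == #|vset G| by rewrite (perm_size pw) cardE.
exists (Tuple sw) => //; rewrite mem_enum inE pw /=.
apply/forall_inP => -[y z]; rewrite EG !inE /= => /and3P[yz yG zG].
by apply: lw => //; rewrite wS.
Qed.

(** * Chains and circuits through their vertex words *)

Section ChainWords.

Variables (T : finType) (G : digraph T).
Hypothesis Gacyclic : forall c : seq (T * T), ~~ circuit G c.
Hypothesis Gtrans : forall e : T * T, ~ transitivity_edge G e.

Notation edge := (fun y z : T => (y, z) \in eset G).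

Lemma chain_zip (c : seq (T * T)) : sorted (@consecutive T) c ->
  c = zip (chain_word c) (behead (chain_word c)).
Proof.
case: c => //= e c; elim: c e => [|f c IH] [y z] //=.
by case/andP=> /eqP /= -> /IH {1}->.
Qed.

Lemma sorted_zip (w : seq T) :
  sorted edge w = all (mem (eset G)) (zip w (behead w)).
Proof. by case: w => //= y w; elim: w y => //= z w IH y; rewrite IH. Qed.

Lemma consecutive_zip (w : seq T) :
  sorted (@consecutive T) (zip w (behead w)).
Proof.
case: w => // y w; elim: w y => // z [|t w] // IH y.
by apply/andP; split; [exact: eqxx | exact: IH].
Qed.

Lemma map_fst_zip (y : T) (w : seq T) z :
  [seq e.1 | e <- zip (y :: w) (rcons w z)] = y :: w.
Proof. by apply: unzip1_zip; rewrite size_rcons. Qed.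

Lemma chain_word_zip (y z : T) (w : seq T) :
  chain_word (zip [:: y, z & w] (z :: w)) = [:: y, z & w].
Proof.
have /= := @unzip2_zip _ _ [:: y, z & w] (z :: w) (leqnSn _).
by move=> /= ->.
Qed.

Lemma chain_of_word (y z : T) (w : seq T) :
    sorted edge [:: y, z & w] -> uniq [:: y, z & w] ->
  chain_from_to G y (last z w) (zip [:: y, z & w] (z :: w)).
Proof.
move=> ch un; have uz : uniq (zip [:: y, z & w] (z :: w)).
  by apply: (@map_uniq _ _ snd); rewrite -/unzip2 unzip2_zip //; case/andP: un.
rewrite /chain_from_to /chain chain_word_zip un uz.
rewrite (consecutive_zip [:: y, z & w]) -(sorted_zip [:: y, z & w]) ch /=.
by rewrite eqxx /=; elim: w y z {ch un uz} => //= t w IH y z.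
Qed.

Lemma circuit_of_word (y : T) (w : seq T) :
    path edge y w -> uniq (y :: w) -> (last y w, y) \in eset G ->
  circuit G (zip (y :: w) (rcons w y)).
Proof.
move=> ch un ly.
have uz : uniq (zip (y :: w) (rcons w y)).
  by apply: (@map_uniq _ _ fst); rewrite map_fst_zip.
rewrite /circuit map_fst_zip un uz !andbT.
have all1 v : (last y w, v) \in eset G ->
    all (mem (eset G)) (zip (y :: w) (rcons w v)).
  by elim: (w) (y) ch => [|t r IH] s /=; [rewrite andbT | case/andP=> -> /IH].
rewrite all1 //=.
(* The closing pair [(v, b)] is kept general for the induction; it becomes the first edge [(y, t)],
   to which a cycle has to return. *)
have cyc a t v b r :
    path (@consecutive T) (a, t) (rcons (zip (t :: r) (rcons r v)) (v, b)).
  elim: r a t => [|s r IH] a t; first by rewrite /= /consecutive /= !eqxx.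
  by apply/andP; split; [exact: eqxx | exact: IH].
case: (w) => [|t r]; last exact: (cyc y t y t r).
by rewrite /= /consecutive /= eqxx.
Qed.

(** A backward edge or a loop would close a segment of the chain to a circuit, and an edge skipping
    a vertex would be a transitivity edge. *)
Lemma edge_in_word (w : seq T) y z : sorted edge w -> uniq w ->
    (y, z) \in eset G -> y \in w -> z \in w ->
  exists p q, w = p ++ [:: y, z & q].
Proof.
move=> ch un yz yw zw.
have [p [q dw]] : exists p q, w = p ++ y :: q.
  by case/splitPr: yw => p q; exists p, q.
have [zq|zq] := boolP (z \in q); last first.
  (* Here [z] occurs no later than [y]; keeping [y] in the prefix covers the loop [z = y], where
     [p2] is empty. *)
  move: ch un zw; rewrite dw -cat_rcons => ch un.
  rewrite mem_cat (negPf zq) orbF => zp.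
  have [p1 [p2 dp]] : exists p1 p2, rcons p y = p1 ++ z :: p2.
    by case/splitPr: zp => p1 p2; exists p1, p2.
  have ly : last z p2 = y by have := last_rcons z p y; rewrite dp last_cat.
  case/negP: (Gacyclic (zip (z :: p2) (rcons p2 z))); apply: circuit_of_word.
  - by have := cat_sorted2 ch; rewrite dp => -[/cat_sorted2[_]].
  - move: un; rewrite dp -catA cat_uniq => /and3P[_ _].
    by rewrite cat_uniq => /and3P[].
  - by rewrite ly.
have [q1 [q2 dq]] : exists q1 q2, q = q1 ++ z :: q2.
  by case/splitPr: zq => q1 q2; exists q1, q2.
case: q1 dq => [|t q1] dq; first by exists p, q2; rewrite dw dq.
case: (Gtrans (e := (y, z))); split=> //.
(* The segment of the chain from [y] to [z] passes through [t], hence has at least two edges. *)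
exists (zip [:: y, t & rcons q1 z] (t :: rcons q1 z)); last first.
  by rewrite size_zip /= size_rcons minnE subKn.
have dw' : w = p ++ ([:: y, t & rcons q1 z] ++ q2).
  by rewrite dw dq /= cat_rcons.
have := @chain_of_word y t (rcons q1 z); rewrite last_rcons; apply.
  by have := ch; rewrite dw' => /cat_sorted2[_ /cat_sorted2[]].
move: un; rewrite dw' cat_uniq => /and3P[_ _].
by rewrite cat_uniq => /and3P[].
Qed.

Lemma no_loop z : (z, z) \notin eset G.
Proof.
apply/negP => zz; have /negP[] := Gacyclic [:: (z, z)].
by rewrite /circuit /= /consecutive /= zz eqxx.
Qed.

(** By [edge_in_word], an edge from a later vertex into the first one would force the first vertex
    to occur again. *)
Lemma no_back_edge (w : seq T) : sorted edge w -> uniq w ->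
  pairwise (fun y z => (z, y) \notin eset G) w.
Proof.
elim: w => // t w IH ch un; have /andP[tw uw] := un.
rewrite pairwise_cons IH ?(path_sorted ch) // andbT.
apply/allP => z zw; apply/negP => e.
have zt : z != t by apply: contraNneq tw => <-.
case: (edge_in_word ch un e); rewrite ?inE ?eqxx ?zw ?orbT //.
case=> [|s p] [q] [ts].
  by rewrite ts eqxx in zt.
by move=> dw; case/negP: tw; rewrite dw mem_cat !inE eqxx !orbT.
Qed.

Lemma mem_zip_behead (p q : seq T) y z :
  (y, z) \in zip (p ++ [:: y, z & q]) (behead (p ++ [:: y, z & q])).
Proof.
elim: p => [|t p IH] /=; first by rewrite inE eqxx.
by case: p IH => [|s p] /= IH; rewrite inE IH orbT.
Qed.

End ChainWords.

(** * Connected components *)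

Section Regions.

Variables (T : finType) (G : digraph T).

(* [symmetric] alone refers to symmetric polynomials here. *)
Lemma adjacent_sym : ssrbool.symmetric (adjacent G).
Proof. by move=> y z; rewrite /adjacent /= orbC. Qed.

Lemma connect_adjacent_equiv :
  {in vset G & &, equivalence_rel (connect (adjacent G))}.
Proof.
move=> y z t _ _ _; split=> [|yz]; first exact: connect0.
exact: (same_connect (sym_connect_sym adjacent_sym)).
Qed.

Lemma components_partition : partition (components G) (vset G).
Proof. exact: equivalence_partitionP connect_adjacent_equiv. Qed.

Lemma components_adjacent (C D : {set T}) y z :
    C \in components G -> D \in components G -> y \in C -> z \in D ->
  adjacent G y z -> C = D.
Proof.
have /and3P[/eqP cov triv _] := components_partition.
move=> CP DP yC zD yz.
have sub B t : B \in components G -> t \in B -> t \in vset G.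
  by move=> BP tB; rewrite -cov; apply/bigcupP; exists B.
have := pblock_equivalence_partition connect_adjacent_equiv
  (sub C y CP yC) (sub D z DP zD).
rewrite -/(components G) (def_pblock triv CP yC) connect1 // => zC.
by rewrite -(def_pblock triv CP zC) (def_pblock triv DP zD).
Qed.

End Regions.

(** * Factorisation of the numerator over the regions *)

Lemma numer_chain (T : finType) (G : digraph T) (c : seq (T * T)) :
    {subset c <= eset G} -> uniq c ->
  numer G = Psi G / (\prod_(e <- c) (xvar e.1 - xvar e.2)^-1)
    * \prod_(e in eset G | e \notin c) (xvar e.1 - xvar e.2).
Proof.
(* The factors of the chain edges are inverted twice, so that they appear as division by P(w). *)
move=> cG uc; rewrite /numer (bigID (mem c)) /= mulrA prodfV invrK.
congr (_ * _ * _); rewrite [RHS]big_uniq //; apply: eq_bigl => e.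
by rewrite andb_idl //; apply: cG.
Qed.

Lemma mem_zip_inv (S S' : eqType) (s : seq S) (s' : seq S') y z :
  (y, z) \in zip s s' -> y \in s /\ z \in s'.
Proof.
elim: s s' => [|a s IH] [|b s'] //=.
rewrite !inE => /orP[/eqP[-> ->]|/IH[-> ->]].
  by rewrite !eqxx.
by rewrite !orbT.
Qed.

Theorem mainTheorem8 (T : finType) (G : digraph T)
    (Gconn : connected_graph G)
    (Gacyclic : forall c : seq (T * T), ~~ circuit G c)
    (Gtrans : forall e : T * T, ~ transitivity_edge G e)
    (c : seq (T * T)) (cG : chain G c) :
  numer G =
    \prod_(C in components (induced G (vset G :\: chain_vset c)))
      numer (induced G (C :|: chain_vset c)).
Proof.
set W := chain_vset c; set H := induced G (vset G :\: W).
have /and5P[c0 /allP cE0 cs uc uw] := cG.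
have cE : {subset c <= eset G} := cE0.
set w := chain_word c in uw *.
have cw : c = zip w (behead w) by apply: chain_zip.
have w0 : w != [::] by rewrite /w; case: (c) c0.
have chw : sorted (fun y z => (y, z) \in eset G) w.
  by rewrite sorted_zip -cw; apply/allP.
have memW y : (y \in W) = (y \in w) by rewrite inE.
have edgeW y z : (y, z) \in eset G -> y \in W -> z \in W -> (y, z) \in c.
  rewrite !memW => yz yw zw.
  have [p [q dw]] := edge_in_word Gacyclic Gtrans chw uw yz yw zw.
  by rewrite cw dw mem_zip_behead.
have edgeV y z : (y, z) \in eset G -> y \in vset G /\ z \in vset G.
  by move/(subsetP (eset_sub G)); rewrite inE => /andP[].
have ecW y z : (y, z) \in c -> y \in W /\ z \in W.
  by rewrite !memW cw => /mem_zip_inv[-> /mem_behead].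
have WV y : y \in W -> y \in vset G.
  have cV e : e \in c -> e.1 \in vset G /\ e.2 \in vset G.
    by move=> /cE; case: e => ? ? /edgeV.
  rewrite memW /w; case: (c) cV => // e c' cV.
  rewrite /chain_word in_cons => /orP[/eqP->|/mapP[f fc ->]]; last first.
    by case: (cV f fc).
  by case: (cV e (mem_head _ _)).
have HV y : (y \in vset H) = (y \in vset G) && (y \notin W).
  by rewrite !in_setI in_setD; case: (y \in vset G); rewrite ?andbF // andbT.
set P := components H.
have /and3P[/eqP cov triv _] := components_partition H; rewrite -/P in cov triv.
have CV C y : C \in P -> y \in C -> (y \in vset G) && (y \notin W).
  by move=> CP yC; rewrite -HV -cov; apply/bigcupP; exists C.
have compH y : y \in vset G -> y \notin W -> exists2 C, C \in P & y \in C.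
  by move=> yV yW; apply/bigcupP; rewrite -/(cover P) cov HV yV.
have VG : vset G = \bigcup_(C <- enum P) C :|: [set:: w].
  rewrite big_enum -/(cover P) cov; apply/setP => y; rewrite in_setU HV -/W.
  by have [/WV ->|] := boolP (y \in W); rewrite ?andbF ?orbF ?andbT.
have adjP C D y z : C \in P -> D \in P -> y \in C -> z \in D ->
    (y, z) \in eset G -> C = D.
  move=> CP DP yC zD yz; apply: (components_adjacent CP DP yC zD).
  have [/andP[yV yW] /andP[zV zW]] := (CV _ _ CP yC, CV _ _ DP zD).
  by apply/orP; left; rewrite in_setI yz in_setX !HV yV yW zV zW.
have WE : \prod_(e <- c) (xvar e.1 - xvar e.2)^-1 = weight (@xvar T) None w.
  by rewrite weight_zip -cw.
have VC C : C \in P -> vset (induced G (C :|: W)) = C :|: [set:: w].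
  move=> CP; apply/setIidPr/subsetP => y.
  by case/setUP=> [/(CV _ _ CP)/andP[] //|]; apply: WV.
have EC C y z : ((y, z) \in eset (induced G (C :|: W))) =
    [&& (y, z) \in eset G, y \in C :|: W & z \in C :|: W].
  rewrite in_setI in_setX !in_setI /=.
  by have [/edgeV[-> ->]|] := boolP (_ \in eset G).
rewrite (numer_chain cE uc) WE (Psi_rooted_sum (E := eset G)); last first.
  by apply/esym/setIidPl/eset_sub.
under [RHS]eq_bigr => C CP.
  rewrite (numer_chain (c := c)) // ?WE; last first.
    move=> [y z] yz; have [yW zW] := ecW _ _ yz.
    by rewrite EC (cE _ yz) !in_setU yW zW !orbT.
  rewrite (Psi_rooted_sum (E := eset G)) // VC //.
  over.
(* The quotients of [Psi] by P(w) and the products over the edges off the chain are matched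
   separately. *)
rewrite big_split /=; congr (_ * _).
  rewrite [X in rooted_sum _ _ _ X]VG rooted_sum_chain_bigcup ?big_enum //.
  - exact: xvar_inj.
  - exact: no_back_edge.
  - by move=> z _; apply: no_loop.
  - exact: enum_uniq.
  - move=> C D; rewrite !mem_enum => CP DP CD y z yC zD.
    split; last 2 first.
    + by apply: contraNN CD => yz; apply/eqP; apply: adjP yz.
    + rewrite eq_sym in CD.
      by apply: contraNN CD => yz; apply/eqP; apply: adjP yz.
    apply: contraNneq CD => yz; rewrite -yz in zD.
    by rewrite -(def_pblock triv CP yC) -(def_pblock triv DP zD).
  - move=> C; rewrite mem_enum => CP; rewrite disjoint_subset.
    by apply/subsetP => y /(CV _ _ CP)/andP[_]; rewrite memW.
(* With the products exchanged, the claim is that each edge off the chain lies in exactly one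
   region. *)
rewrite (exchange_big_dep (fun e => (e \in eset G) && (e \notin c))) /=;
  last first.
  by move=> C [y z] _; rewrite EC => /andP[/andP[-> _]].
apply: eq_bigr => -[y z] /andP[yz nc].
(* By [edgeW], such an edge has an endpoint off [W], whose component is the only candidate; the
   other endpoint lies on [W] or, by [adjP], in the same component. *)
have [C0 C0P [yC0 zC0 C0u]] : exists2 C0, C0 \in P &
    [/\ y \in C0 :|: W, z \in C0 :|: W &
       forall C, C \in P -> y \in C :|: W -> z \in C :|: W -> C = C0].
  have [yV zV] := edgeV _ _ yz.
  have inC C t : t \notin W -> t \in C :|: W -> t \in C.
    by move=> tW /setUP[] // tW'; rewrite tW' in tW.
  have same C D t : C \in P -> D \in P -> t \in C -> t \in D -> C = D.
    move=> CP DP tC tD.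
    by rewrite -(def_pblock triv CP tC) (def_pblock triv DP tD).
  have [yW|yW] := boolP (y \in W).
    have zW : z \notin W by apply: contraNN nc; apply: edgeW.
    have [C CP zC] := compH z zV zW; exists C => //.
    rewrite !in_setU yW zC orbT.
    by split=> // D DP _ /(inC _ _ zW) zD; apply: same zD zC.
  have [C CP yC] := compH y yV yW; exists C => //.
  rewrite in_setU yC; split=> //.
    have [zW|zW] := boolP (z \in W); first by rewrite in_setU zW orbT.
    have [D DP zD] := compH z zV zW.
    by rewrite in_setU (adjP _ _ _ _ CP DP yC zD yz) zD.
  by move=> D DP /(inC _ _ yW) yD _; apply: same yD yC.
rewrite (big_pred1 C0) // => C; rewrite EC yz nc andbT /=.
by apply/and3P/eqP => [[CP yC zC]|->]; [apply: C0u | split].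
Qed.
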